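(* Let $K$ be a compact Hausdorff space and let $\kappa$ be a cardinal. Assume that there is a family of $\kappa$ many pairwise disjoint non-empty clopen subsets of $K$. Then the set $$\{f\in C(K): |\operatorname{rng}(f)|=\omega\}\cup\{0\}$$ contains an isometric copy of $c_0(\kappa)$.
   Context: $C(K)$ is the Banach space of real-valued continuous functions on $K$ with the supremum norm; $\operatorname{rng}(f)=f(K)$ is the range of $f$; $|\operatorname{rng}(f)|=\omega$ means that the range is countably infinite. Clopen means closed and open. For a cardinal $\kappa$, $c_0(\kappa)=\{x\in\mathbb{R}^\kappa : \{\alpha<\kappa : |x(\alpha)|>\varepsilon\}\text{ is finite for every }\varepsilon>0\}$, equipped with the supremum norm. An isometric copy of a Banach space $Z$ in $C(K)$ means a linear subspace of $C(K)$ which is the image of $Z$ under a linear isometry.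
   Formalization: The cardinal κ is assumed infinite; for finite κ ≥ 1 the claim can fail (K a single point, κ = 1: every function has finite range, so the set is {0} and contains no copy of c_0(1) = ℝ). *)

(* Defs.v *)
From HB Require Import structures.
From mathcomp Require Import all_boot all_order all_algebra.
From mathcomp Require Import all_classical all_reals all_analysis.

Set Implicit Arguments.
Unset Strict Implicit.
Unset Printing Implicit Defensive.

Import Order.TTheory GRing.Theory Num.Theory.
Import numFieldNormedType.Exports.

Local Open Scope classical_set_scope.
Local Open Scope ring_scope.

Section sup_norm.
Context {R : realType} {T : Type}.
Implicit Types f g : T -> R.

(* On an empty domain this is [sup set0 = 0]. *)
Definition supnorm f : R := sup (range (fun t => `|f t|)).

Definition supbounded f := has_ubound (range (fun t => `|f t|)).

Lemma supnorm_ub f t : supbounded f -> `|f t| <= supnorm f.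
Proof. by move=> bf; apply: ub_le_sup => //; exists t. Qed.

Lemma supnorm_ge0 f : 0 <= supnorm f.
Proof.
rewrite /supnorm.
have [[[r rf] bf]|nsup] := pselect (has_sup (range (fun t => `|f t|))).
  by case: (rf) => t _ tr; rewrite (le_trans _ (ub_le_sup bf rf))// -tr.
by rewrite sup_out.
Qed.

Lemma supnorm_le f (M : R) : 0 <= M -> (forall t, `|f t| <= M) -> supnorm f <= M.
Proof.
move=> M0 fM; have [e|ne] := eqVneq (range (fun t => `|f t|)) set0.
  by rewrite /supnorm e sup0.
by apply: ge_sup; [exact/set0P|move=> _ [t _ <-]].
Qed.

Lemma supnormD f g : supbounded f -> supbounded g ->
  supnorm (f + g) <= supnorm f + supnorm g.
Proof.
move=> bf bg; apply: supnorm_le => [|t]; first by rewrite addr_ge0 ?supnorm_ge0.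
by rewrite (le_trans (ler_normD _ _))// lerD// supnorm_ub.
Qed.

Lemma supnormZ (a : R) f : supbounded f -> supnorm (a *: f) = `|a| * supnorm f.
Proof.
move=> bf; have leZ (b : R) (h : T -> R) : supbounded h ->
    supnorm (b *: h) <= `|b| * supnorm h.
  move=> bh; apply: supnorm_le => [|t]; first by rewrite mulr_ge0 ?supnorm_ge0.
  by rewrite [X in `|X|]/(b * h t) normrM ler_wpM2l// supnorm_ub.
apply/eqP; rewrite eq_le leZ//=.
have [->|a0] := eqVneq a 0; first by rewrite normr0 mul0r supnorm_ge0.
have bZ : supbounded (a *: f).
  exists (`|a| * supnorm f) => _ [t _ <-].
  by rewrite [X in `|X|]/(a * f t) normrM ler_wpM2l// supnorm_ub.
rewrite -ler_pdivlMl ?normr_gt0// -normfV.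
by apply: le_trans (leZ _ _ bZ); rewrite scalerA mulVf// scale1r.
Qed.

Lemma supnorm_eq0 f : supbounded f -> supnorm f = 0 -> f = 0.
Proof.
move=> bf f0; apply/funext => t; apply/normr0_eq0/eqP.
by rewrite eq_le normr_ge0 andbT -f0 supnorm_ub.
Qed.

End sup_norm.

Section cfun.
Context (R : realType) (K : topologicalType).

Definition cfun_set : {pred K -> R} := mem [set f : K -> R | continuous f].

Lemma cfun_set_submod_closed : submod_closed cfun_set.
Proof.
split=> [|a f g]; first by apply/mem_set => x; exact: cvg_cst.
move=> /set_mem cf /set_mem cg; apply/mem_set => x.
by apply: cvgD; [apply: cvgZr; exact: cf|exact: cg].
Qed.

HB.instance Definition _ :=
  GRing.isSubmodClosed.Build R (K -> R) cfun_set cfun_set_submod_closed.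

(* [C(K)]; the type records the compactness of [K], since the supremum norm is
   a norm only because continuous functions on [K] are bounded. *)
Record cfun (Kcpt : compact [set: K]) :=
  CFun { cfun_val :> K -> R ; _ : cfun_val \in cfun_set }.

Context (Kcpt : compact [set: K]).
Local Notation CK := (cfun Kcpt).

HB.instance Definition _ := [isSub of CK for @cfun_val Kcpt].
HB.instance Definition _ := [Choice of CK by <:].
HB.instance Definition _ := [SubChoice_isSubLmodule of CK by <:].

Lemma cfun_continuous (f : CK) : continuous f.
Proof. exact: (set_mem (valP f)). Qed.

Lemma cfun_bounded (f : CK) : supbounded f.
Proof.
have cf : {within [set: K], continuous (f : K -> R)}.
  by apply: continuous_subspaceT; exact: cfun_continuous.
have [M [_ bM]] := compact_bounded (continuous_compact cf Kcpt).
exists (M + 1) => _ [t _ <-]; apply: (bM (M + 1)); last by exists t.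
by rewrite ltrDl.
Qed.

Let cfun_ler_normD (f g : CK) :
  supnorm (f + g : CK) <= supnorm f + supnorm g.
Proof. by apply: supnormD; exact: cfun_bounded. Qed.

Let cfun_normrZ (a : R) (f : CK) : supnorm (a *: f : CK) = `|a| * supnorm f.
Proof. by apply: supnormZ; exact: cfun_bounded. Qed.

Let cfun_normr0_eq0 (f : CK) : supnorm f = 0 -> f = 0.
Proof.
by move=> f0; apply: val_inj; exact: (supnorm_eq0 (cfun_bounded f) f0).
Qed.

HB.instance Definition _ :=
  Lmodule_isNormed.Build R CK cfun_ler_normD cfun_normrZ cfun_normr0_eq0.

Lemma cfun_normE (f : CK) : `|f| = sup (range (fun t => `|f t|)).
Proof. by []. Qed.

End cfun.

Section c0.
(* A cardinal is represented by an index type [I] of that cardinality. *)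
Context (R : realType) (I : Type).

Definition c0_set : {pred I -> R} :=
  mem [set x : I -> R | forall e : R, 0 < e -> finite_set [set i | e < `|x i|]].

Lemma c0_set_submod_closed : submod_closed c0_set.
Proof.
split=> [|a x y].
  apply/mem_set => e e0; rewrite (_ : [set _ | _] = set0)//.
  by apply/seteqP; split => // i /=; rewrite normr0 ltNge ltW.
move=> /set_mem cx /set_mem cy; apply/mem_set => e e0.
pose d := e / 2 / (`|a| + 1).
have a1 : 0 < `|a| + 1 by rewrite ltr_wpDl.
have e2 : 0 < e / 2 by rewrite divr_gt0.
have d0 : 0 < d by rewrite divr_gt0.
apply: (@sub_finite_set _ _ ([set i | d < `|x i|] `|` [set i | e / 2 < `|y i|])).
  move=> i /= ei; apply: contrapT => /not_orP[/negP + /negP].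
  rewrite -!leNgt => xi yi; move: ei; apply/negP; rewrite -leNgt.
  rewrite [X in `|X|]/(a * x i + y i) (le_trans (ler_normD _ _))// (splitr e).
  rewrite lerD// normrM (@le_trans _ _ ((`|a| + 1) * d))//.
    by rewrite ler_pM// lerDl.
  by rewrite /d mulrC divfK// gt_eqF.
by rewrite finite_setU; split; [exact: cx|exact: cy].
Qed.

HB.instance Definition _ :=
  GRing.isSubmodClosed.Build R (I -> R) c0_set c0_set_submod_closed.

Record c0 := C0 { c0_val :> I -> R ; _ : c0_val \in c0_set }.

HB.instance Definition _ := [isSub of c0 for c0_val].
HB.instance Definition _ := [Choice of c0 by <:].
HB.instance Definition _ := [SubChoice_isSubLmodule of c0 by <:].

Lemma c0_bounded (x : c0) : supbounded x.
Proof.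
have /finite_seqP[s sE] := finite_image (fun i => `|x i|) (set_mem (valP x) 1 ltr01).
exists (1 + \sum_(r <- s) `|r|) => _ [i _ <-].
have [xi|xi] := leP `|x i| 1.
  by rewrite (le_trans xi)// lerDl sumr_ge0.
have : [set `|x j| | j in [set j | 1 < `|x j|]] `|x i| by exists i.
rewrite sE /= => si; rewrite (big_rem _ si)/= normr_id.
by rewrite addrCA lerDl addr_ge0// sumr_ge0.
Qed.

Let c0_ler_normD (x y : c0) : supnorm (x + y : c0) <= supnorm x + supnorm y.
Proof. by apply: supnormD; exact: c0_bounded. Qed.

Let c0_normrZ (a : R) (x : c0) : supnorm (a *: x : c0) = `|a| * supnorm x.
Proof. by apply: supnormZ; exact: c0_bounded. Qed.

Let c0_normr0_eq0 (x : c0) : supnorm x = 0 -> x = 0.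
Proof.
by move=> x0; apply: val_inj; exact: (supnorm_eq0 (c0_bounded x) x0).
Qed.

HB.instance Definition _ :=
  Lmodule_isNormed.Build R c0 c0_ler_normD c0_normrZ c0_normr0_eq0.

Lemma c0_normE (x : c0) : `|x| = sup (range (fun i => `|x i|)).
Proof. by []. Qed.

End c0.

(* No separate subspace condition is needed: [range T] is one by linearity. *)
Definition isometric_copy (R : realType) (Z X : normedModType R) (E : set X) :=
  exists T : {linear Z -> X}, (forall z, `|T z| = `|z|) /\ E = range T.
Arguments isometric_copy {R} Z X E.

(* Main.v *)
Require Import Defs.
From HB Require Import structures.
From mathcomp Require Import all_boot all_order all_algebra.
From mathcomp Require Import all_classical all_reals all_analysis.

Import Order.TTheory GRing.Theory Num.Theory.
Import numFieldNormedType.Exports.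

Local Open Scope classical_set_scope.
Local Open Scope ring_scope.
Local Open Scope card_scope.

(** An infinite index set [I] satisfies [|I * nat| <= |I|], so the clopen sets
    can be re-indexed as a disjoint family [V (i, n)]. Send [x] in [c_0(I)] to
    the function equal to [x i / 2 ^ n] on [V (i, n)] and to [0] elsewhere.
    The values [x i / 2 ^ n] are again in [c_0], which makes the function
    continuous with countable range; its supremum norm is attained on the
    [V (i, 0)]; and a single [x i <> 0] already yields the infinitely many
    values [x i / 2 ^ n]. *)

Lemma infinite_inj_seq (T : Type) (A : set T) : infinite_set A ->
  exists2 s : nat -> T, injective s & range s `<=` A.
Proof.
move=> /infiniteP /card_leP[f].
exists (fun n => set_val (f (exist _ n (mem_setT n)))) => [m n|_ [n _ <-]].
  by move=> /val_inj/(@inj _ _ _ f)/=; rewrite !in_setT => /(_ isT isT)/(congr1 set_val).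
exact: set_valP.
Qed.

(* A maximal disjoint family of injective sequences covers all of [T] but a
   finite set. The even positions of each sequence code its own terms, and the
   odd positions of one chosen sequence [s0] code the finite remainder. This
   embeds [T] in (sequences) * [nat], where a further [nat] factor is absorbed
   by [pickle]. *)
Lemma inj_prod_nat (T : Type) : infinite_set [set: T] ->
  exists p : T * nat -> T, injective p.
Proof.
move=> Tinf.
pose B := [set s : nat -> T | injective s].
have [D [DB Dtriv Dmax]] :=
  ex_maximal_disjoint_subcollection (fun s : nat -> T => range s) B.
have Dfin : finite_set (~` \bigcup_(s in D) range s).
  apply: contrapT => /infinite_inj_seq[s sinj sD].
  have Ds : ~ D s by move=> Ds; case: (sD (s 0%N)) => //; exists s => //; exists 0%N.
  apply: (Dmax (D `|` [set s])).
  - by split=> [u Du|]; [left|move=> /(_ s) H; apply/Ds/H; right].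
  - by move=> u [/DB//|->].
  - move=> u v [Du|->] [Dv|->] //.
    + exact: Dtriv.
    + by move=> [z [[n _ <-] sn]]; case: (sD _ sn) => //; exists u => //; exists n.
    + by move=> [z [sn [n _ nz]]]; rewrite -nz in sn; case: (sD _ sn) => //; exists v => //; exists n.
have [s0 Ds0] : D !=set0.
  apply/set0P/eqP => D0; apply: Tinf; move: Dfin.
  by rewrite D0 bigcup_set0 setC0.
have /countable_injP[e einj] := finite_set_countable Dfin.
have code t : exists c : (nat -> T) * nat, D c.1 /\
    ((exists2 k, c.2 = k.*2 & t = c.1 k) \/
     [/\ c.1 = s0, (~` \bigcup_(s in D) range s) t & c.2 = (e t).*2.+1]).
  have [[s Ds [k _ skt]]|nt] := pselect ((\bigcup_(s in D) range s) t).
    by exists (s, k.*2); split=> //; left; exists k.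
  by exists (s0, (e t).*2.+1); split=> //; right.
have [c cP] := choice code.
have cinj : injective c.
  move=> t u ctu; have [_ ct] := cP t; have [_ cu] := cP u; rewrite -ctu in cu.
  case: ct => [[k kE ->]|[_ tD tE]]; case: cu => [[l lE ->]|[_ uD uE]].
  - by congr ((c t).1 _); apply: double_inj; rewrite -kE -lE.
  - by move: uE; rewrite kE => /(congr1 odd); rewrite /= !odd_double.
  - by move: tE; rewrite lE => /(congr1 odd); rewrite /= !odd_double.
  - apply: einj; rewrite ?inE//.
    by apply: double_inj; apply: succn_inj; rewrite -tE -uE.
exists (fun a => (c a.1).1 (pickle ((c a.1).2, a.2))) => -[t m] [u n] /= tu.
have [Dt _] := cP t; have [Du _] := cP u.
have c1 : (c t).1 = (c u).1.
  apply: Dtriv => //.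
  by eexists; split; [exists (pickle ((c t).2, m)) => //|rewrite tu; eexists].
have uinj : injective (c u).1 := DB _ Du.
move: tu; rewrite c1 => /uinj/(pcan_inj pickleK)[c2 ->].
by congr (_, _); apply: cinj; move: c1 c2; case: (c t) (c u) => [? ?] [? ?] /= -> ->.
Qed.

Section step.
Context {R : realType} {K : topologicalType} {J : Type} (V : J -> set K).
Implicit Types y : J -> R.

(* The pointwise sum of the [y j] times the indicator of [V j], which has at
   most one nonzero term when the [V j] are disjoint. *)
Definition step y (t : K) : R :=
  if pselect (exists j, V j t) is left e then y (projT1 (cid e)) else 0.

Lemma step_out y t : (forall j, ~ V j t) -> step y t = 0.
Proof. by move=> nV; rewrite /step; case: pselect => // e; have [j jt] := e; case: (nV j). Qed.

Hypothesis Vdisj : trivIset [set: J] V.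

Lemma stepE y j t : V j t -> step y t = y j.
Proof.
move=> jt; rewrite /step; case: pselect => [e|]; last by case; exists j.
case: cid => k /= kt; congr y; apply: Vdisj => //.
by exists t.
Qed.

Hypothesis Vclopen : forall j, clopen (V j).

Lemma step_continuous y : (forall e : R, 0 < e -> finite_set [set j | e < `|y j|]) ->
  continuous (step y).
Proof.
move=> cy t; have [[j jt]|/forallNP nt] := pselect (exists j, V j t).
  apply: near_cst_continuous => /=; rewrite /prop_near1/=.
  have : nbhs t (V j) by apply: open_nbhs_nbhs; split=> //; case: (Vclopen j).
  by apply: filterS => s js; rewrite !(stepE _ j).
rewrite /continuous_at step_out//; apply/cvgrPdist_le => e e0.
have : closed (\bigcup_(j in [set j | e < `|y j|]) V j).
  apply: (@closed_bigcup _ {classic J}); first exact: cy.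
  by move=> j _; case: (Vclopen j).
rewrite -openC => oC.
have : nbhs t (~` \bigcup_(j in [set j | e < `|y j|]) V j).
  by apply: open_nbhs_nbhs; split=> // -[j _ /nt].
apply: filterS => s ns; rewrite sub0r normrN.
have [[j js]|/forallNP nVs] := pselect (exists j, V j s); last first.
  by rewrite step_out// normr0 ltW.
by rewrite (stepE _ _ _ js) leNgt; apply/negP => ej; apply: ns; exists j.
Qed.

Lemma step_range_countable y :
  (forall e : R, 0 < e -> finite_set [set j | e < `|y j|]) ->
  countable (range (step y)).
Proof.
move=> cy.
have : countable (\bigcup_n ([set 0] `|` y @` [set j | n.+1%:R^-1 < `|y j|])).
  apply: bigcup_countable => // n _; apply: finite_set_countable.
  by rewrite finite_setU; split=> //; exact/finite_image/cy.
apply: sub_countable; apply: subset_card_le => _ [t _ <-].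
have [[j jt]|/forallNP nt] := pselect (exists j, V j t); last first.
  by exists 0%N => //; left; rewrite step_out.
rewrite (stepE _ _ _ jt); have [->|yj0] := eqVneq (y j) 0; first by exists 0%N => //; left.
exists (Num.trunc `|y j|^-1) => //; right; exists j => //=.
by rewrite invf_plt ?posrE ?normr_gt0// truncnS_gt.
Qed.

End step.

Section dilate.
Context {R : realType} {I : Type}.
Implicit Types x : c0 R I.

Definition dilate (x : I -> R) (a : I * nat) : R := x a.1 * 2^-1 ^+ a.2.

Lemma dilate_c0 x e : 0 < e -> finite_set [set a | e < `|dilate x a|].
Proof.
move=> e0; apply: (@sub_finite_set _ _
  ([set i | e < `|x i|] `*` `I_(Num.trunc (`|x| / e)).+1)); last first.
  by apply: finite_setX => //; exact: (set_mem (valP x)).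
move=> [i n] /=; rewrite /dilate/= normrM normrX (@ger0_norm _ 2^-1) ?invr_ge0// => exi.
split.
  by apply: lt_le_trans exi _; rewrite ler_piMr// exprn_ile1 ?invf_le1 ?ler1n.
rewrite ltnS truncn_ge_nat; last by rewrite divr_ge0// ltW.
rewrite ler_pdivlMr//.
have : e < `|x| * 2^-1 ^+ n.
  apply: (lt_le_trans exi); rewrite ler_wpM2r ?exprn_ge0 ?invr_ge0//.
  exact: supnorm_ub (c0_bounded x).
rewrite exprVn ltr_pdivlMr ?exprn_gt0// => /ltW; apply: le_trans.
by rewrite mulrC ler_pM2l// -natrX ler_nat ltnW// ltn_expl.
Qed.

End dilate.

Theorem theorem6 (R : realType) (K : topologicalType)
    (Kcpt : compact [set: K]) (Khaus : hausdorff_space K)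
    (I : Type) (Iinf : infinite_set [set: I]) (U : I -> set K)
    (Uclopen : forall i, clopen (U i)) (Une : forall i, U i !=set0)
    (Udisj : trivIset [set: I] U) :
  exists E : set (cfun R Kcpt),
    isometric_copy (c0 R I) (cfun R Kcpt) E /\
    E `<=` [set f : cfun R Kcpt | range f #= [set: nat]] `|` [set 0].
Proof.
have [p pinj] := inj_prod_nat _ Iinf.
pose V := U \o p.
have Vdisj : trivIset [set: I * nat] V by move=> a b _ _ ab; exact/pinj/Udisj.
have Vclopen a : clopen (V a) by exact: Uclopen.
pose T (x : c0 R I) : cfun R Kcpt :=
  CFun _ (mem_set (step_continuous _ Vdisj Vclopen _ (dilate_c0 x))).
have TE x i n t : U (p (i, n)) t -> T x t = x i * 2^-1 ^+ n.
  by move=> /= Ut; rewrite (stepE _ Vdisj _ _ _ Ut).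
have Tout x t : (forall a, ~ V a t) -> T x t = 0 by exact: step_out.
have Tlin : linear T.
  suff TD a x y t : T (a *: x + y) t = a * T x t + T y t.
    by move=> a x y; apply/val_inj/funext => t; exact: TD.
  have [[[i n] Ut]|/forallNP nt] := pselect (exists a, V a t).
    by rewrite !(TE _ _ _ _ Ut) [X in X * _](_ : _ = a * x i + y i)// mulrDl mulrA.
  by rewrite !(Tout _ _ nt) mulr0 addr0.
pose TL : {linear c0 R I -> cfun R Kcpt} :=
  HB.pack T (GRing.isLinear.Build R _ _ _ T Tlin).
exists (range T); split.
  exists TL; split=> // x; apply/eqP; rewrite eq_le; apply/andP; split.
    apply: supnorm_le => [|t]; first exact: normr_ge0.
    have [[[i n] Ut]|/forallNP nt] := pselect (exists a, V a t); last first.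
      by rewrite [TL x t](Tout _ _ nt) normr0.
    rewrite [TL x t](TE _ _ _ _ Ut) normrM normrX.
    rewrite (@ger0_norm _ 2^-1) ?invr_ge0// (@le_trans _ _ `|x i|)//.
      by rewrite ler_piMr// exprn_ile1 ?invf_le1 ?ler1n.
    exact: supnorm_ub (c0_bounded x).
  apply: supnorm_le => [|i]; first exact: normr_ge0.
  have [t Ut] := Une (p (i, 0%N)).
  have := supnorm_ub t (cfun_bounded (T x)).
  by rewrite (TE _ _ _ _ Ut) expr0 mulr1.
move=> _ [x _ <-]; have [[i xi]|/forallNP x0] := pselect (exists i, x i <> 0).
  left; apply: eq_card_nat.
    exact: (step_range_countable _ Vdisj _ (dilate_c0 x)).
  have finj : injective (fun n => x i * 2^-1 ^+ n).
    move=> m n /(mulfI (introN eqP xi)); apply: ieexprIn; first by rewrite invr_gt0.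
    by rewrite invr_eq1 (eqr_nat _ 2 1).
  have := card_esym (inj_card_eq (A := [set: nat]) (in2W finj)).
  rewrite card_eq_le => /andP[+ _] => /card_le_trans-lefx.
  apply/infiniteP/lefx/subset_card_le => _ [n _ <-].
  have [t Ut] := Une (p (i, n)).
  by exists t => //; rewrite (TE _ _ _ _ Ut).
right; have -> : x = 0 by apply/val_inj/funext => i; apply: contrapT; exact: x0.
exact: (linear0 TL).
Qed.
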